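(* Let $0<\alpha<1$, let $n\ge 1$ be an integer, and let $p$ be an integer with $1\le p\le 2n$. Let $U_\alpha(m)=\Gamma(m+\alpha-1)/\Gamma(m)$ for integers $m\ge 1$ and $U_\alpha(m)=0$ for integers $m\le 0$, and let $$S_{p,2n}=\sum_{k=0}^{\infty}\Bigl[U_\alpha(2nk+p-1)-U_\alpha(2nk+p)\Bigr].$$ Then $$S_{p,2n}=\frac{\Gamma(\alpha)\,2^{-\alpha}}{n}(-1)^p\left[1+2\sum_{j=1}^{n-1}\Bigl(\cos\frac{\pi j}{2n}\Bigr)^{1-\alpha}\cos\frac{\pi j(2p+\alpha-3)}{2n}\right].$$
   Context: $\Gamma$ is the Euler Gamma function. The function $U_\alpha$ is the falling factorial kernel of Caputo fractional difference maps of order $\alpha$: $U_\alpha(m)=(m+\alpha-2)^{(\alpha-1)}$ for $m\ge1$, where the falling factorial is $t^{(\beta)}=\Gamma(t+1)/\Gamma(t+1-\beta)$; in particular $U_\alpha(1)=\Gamma(\alpha)$. For a period $l\ge 1$ and $1\le p\le l$, the coefficients in the equations defining asymptotically period-$l$ points are $S_{p,l}=\sum_{k=0}^{\infty}[U_\alpha(lk+p-1)-U_\alpha(lk+p)]$; here $l=2n$ is even. An empty sum equals $0$. *)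

(* Defs.v *)
From Stdlib Require Export Reals ZArith.
From Coquelicot Require Export Coquelicot.
Open Scope R_scope.

(* Euler's integral on (0, +oo), improper at both ends.  It converges exactly
   when 0 < x; for x <= 0 the value is meaningless. *)
Definition Gamma (x : R) : R :=
  RInt_gen (fun t : R => Rpower t (x - 1) * exp (- t))
           (at_right 0) (Rbar_locally p_infty).

(* For 1 <= m this is the falling factorial (m + alpha - 2)^(alpha - 1), where
   t^(beta) = Gamma (t + 1) / Gamma (t + 1 - beta).  When 0 < alpha, both
   arguments of Gamma are positive. *)
Definition U (alpha : R) (m : Z) : R :=
  if Z_le_dec 1 m then Gamma (IZR m + alpha - 1) / Gamma (IZR m) else 0.

Definition S_term (alpha : R) (p l k : nat) : R :=
  let m := (Z.of_nat l * Z.of_nat k + Z.of_nat p)%Z in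
  U alpha (m - 1) - U alpha m.

(* [Series] is total: convergence is [ex_series (S_term alpha p l)]. *)
Definition S_coef (alpha : R) (p l : nat) : R := Series (S_term alpha p l).

(* Main.v *)
Require Import Defs.
From Stdlib Require Import Reals ZArith Lra Lia.
From Coquelicot Require Import Coquelicot.
Open Scope R_scope.

(** By the functional equation of Gamma, [U alpha (i + 1) / Gamma alpha] is the coefficient
    of [z^i] in [(1 - z)^(- alpha)], so its differences are the coefficients of
    [(1 - z)^s] with [s = 1 - alpha], i.e. [(-1)^i] times the binomial coefficients
    [gbinom s i] of [(1 + z)^s].  Since [0 < s < 1] these are absolutely summable, hence
    the binomial series represents [(1 + z)^s] on the whole closed disk, and it vanishes
    at [z = -1].  Selecting the indices congruent to [p - 1] modulo [2 n] by averaging over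
    the points [z = exp (i pi j / n)], with [j] and [- j] paired, gives the formula:
    [1 + exp (i x) = 2 cos (x / 2) exp (i x / 2)]. *)

(** * Euler's integral *)

(** For a nonnegative integrand the integral over [[a, b]] grows with the interval, so under a
    uniform bound it converges to its supremum as the two ends move out independently. *)
Lemma ex_RInt_gen_pos_bounded (f : R -> R) (M : R) :
  (forall t, 0 < t -> continuous f t) ->
  (forall t, 0 < t -> 0 <= f t) ->
  (forall a b, 0 < a <= b -> RInt f a b <= M) ->
  ex_RInt_gen f (at_right 0) (Rbar_locally p_infty).
Proof.
  intros Hc Hp HM.
  assert (Hex : forall a b, 0 < a <= b -> ex_RInt f a b).
  { intros a b Hab. apply (ex_RInt_continuous (V := R_CompleteNormedModule)).
    intros z. rewrite Rmin_left by lra. intros Hz. apply Hc. lra. }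
  destruct (completeness (fun y => exists a b, 0 < a <= b /\ y = RInt f a b))
    as [l [Hub Hlub]].
  { exists M. intros y (a & b & Hab & ->). now apply HM. }
  { exists (RInt f 1 1), 1, 1. split; [lra | easy]. }
  exists l. apply filterlimi_locally. intros eps.
  assert (Hab0 : exists a0 b0, 0 < a0 <= b0 /\ l - eps < RInt f a0 b0).
  { destruct (Classical_Prop.classic
      (exists a0 b0, 0 < a0 <= b0 /\ l - eps < RInt f a0 b0)) as [|Hn]; [easy|].
    exfalso. assert (Hl : l <= l - eps).
    { apply Hlub. intros y (a & b & Hab & ->).
      apply Rnot_lt_le. intros Hlt. apply Hn. now exists a, b. }
    generalize (cond_pos eps). lra. }
  destruct Hab0 as (a0 & b0 & Hab0 & Hl).
  (* Once [[a0, b0]] comes within [eps] of the supremum, so does every larger interval. *)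
  apply (Filter_prod _ _ _ (fun a => 0 < a < a0) (fun b => b0 < b)).
  - exists (mkposreal a0 (proj1 Hab0)). intros y Hy Hy0. split; [easy|].
    unfold ball in Hy; simpl in Hy. unfold AbsRing_ball, abs, minus, plus, opp in Hy.
    simpl in Hy. apply Rabs_def2 in Hy. lra.
  - now exists b0.
  - intros a b Ha Hb. exists (RInt f a b). split; simpl.
    + apply (RInt_correct (V := R_CompleteNormedModule)). apply Hex. lra.
    + assert (H1 : RInt f a b <= l).
      { apply Hub. exists a, b. split; [lra | easy]. }
      assert (H2 : RInt f a0 b0 <= RInt f a b).
      { rewrite <- (RInt_Chasles (V := R_CompleteNormedModule) f a a0 b) by (apply Hex; lra).
        rewrite <- (RInt_Chasles (V := R_CompleteNormedModule) f a0 b0 b) by (apply Hex; lra).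
        assert (0 <= RInt f a a0).
        { apply RInt_ge_0; [lra | apply Hex; lra |]. intros; apply Hp; lra. }
        assert (0 <= RInt f b0 b).
        { apply RInt_ge_0; [lra | apply Hex; lra |]. intros; apply Hp; lra. }
        unfold plus; simpl. lra. }
      unfold ball; simpl. unfold AbsRing_ball, abs, minus, plus, opp; simpl.
      apply Rabs_def1; generalize (cond_pos eps); lra.
Qed.

Lemma Rpower_le_add_1 (t x : R) : 0 < t -> 0 < x <= 1 -> Rpower t x <= 1 + t.
Proof.
  intros Ht Hx. destruct (Rle_dec t 1) as [H1|H1].
  - assert (Rpower t x <= 1).
    { replace 1 with (Rpower 1 x) by (unfold Rpower; rewrite ln_1, Rmult_0_r; apply exp_0).
      apply Rle_Rpower_l; lra. }
    lra.
  - apply Rle_trans with (Rpower t 1).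
    + apply Rle_Rpower; lra.
    + rewrite Rpower_1; lra.
Qed.

Definition gamma_integrand (x t : R) : R := Rpower t (x - 1) * exp (- t).

Lemma gamma_integrand_pos (x t : R) : 0 < gamma_integrand x t.
Proof. apply Rmult_lt_0_compat; apply exp_pos. Qed.

Lemma continuous_gamma_integrand (x t : R) : 0 < t -> continuous (gamma_integrand x) t.
Proof.
  intros Ht. apply (ex_derive_continuous (V := R_NormedModule)). unfold gamma_integrand, Rpower.
  auto_derive. lra.
Qed.

(* [4/x * t^x / (1 + t^x)] is bounded, and its derivative [4 t^(x-1) / (1 + t^x)^2]
   dominates the integrand since [1 + t^x <= 2 + t <= 2 exp (t/2)]. *)
Lemma ex_RInt_gen_gamma_small (x : R) : 0 < x <= 1 ->
  ex_RInt_gen (gamma_integrand x) (at_right 0) (Rbar_locally p_infty).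
Proof.
  intros Hx. apply ex_RInt_gen_pos_bounded with (4 / x).
  - apply continuous_gamma_integrand.
  - intros; apply Rlt_le, gamma_integrand_pos.
  - intros a b Hab.
    set (H := fun t => 4 / x * (1 - / (1 + exp (x * ln t)))).
    set (h := fun t => 4 * exp ((x - 1) * ln t) / (1 + exp (x * ln t)) ^ 2).
    assert (HI : is_RInt h a b (minus (H b) (H a))).
    { apply (is_RInt_derive (V := R_CompleteNormedModule));
        rewrite Rmin_left, Rmax_right by lra; intros t Ht.
      - unfold H, h. assert (He := exp_pos (x * ln t)).
        auto_derive.
        + split; [lra|]. split; [lra | easy].
        + replace ((x - 1) * ln t) with (x * ln t + - ln t) by ring.
          rewrite exp_plus, exp_Ropp, exp_ln by lra. field. lra.
      - apply (ex_derive_continuous (V := R_NormedModule)). unfold h.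
        assert (He := exp_pos (x * ln t)).
        auto_derive. repeat split; try lra. apply Rgt_not_eq; nra. }
    apply Rle_trans with (minus (H b) (H a)).
    + rewrite <- (is_RInt_unique _ _ _ _ HI).
      apply RInt_le; [lra | | now exists (minus (H b) (H a)) | ].
      { apply (ex_RInt_continuous (V := R_CompleteNormedModule)).
        intros z. rewrite Rmin_left by lra. intros Hz. apply continuous_gamma_integrand. lra. }
      intros t Ht. unfold gamma_integrand, h. change (exp ((x - 1) * ln t)) with (Rpower t (x - 1)).
      change (exp (x * ln t)) with (Rpower t x).
      assert (H1 := Rpower_le_add_1 t x ltac:(lra) Hx).
      assert (H2 : 0 < Rpower t x) by apply exp_pos.
      assert (H3 : 0 < Rpower t (x - 1)) by apply exp_pos.
      assert (H4 := exp_ineq1_le (t / 2)).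
      assert (H5 : exp t = exp (t / 2) * exp (t / 2)) by (rewrite <- exp_plus; f_equal; field).
      assert (H6 : (1 + Rpower t x) ^ 2 <= 4 * exp t) by (rewrite H5; nra).
      rewrite exp_Ropp. assert (H7 := exp_pos t).
      assert (Hq : 0 < (1 + Rpower t x) ^ 2) by nra.
      apply Rmult_le_reg_r with ((1 + Rpower t x) ^ 2 * exp t); [nra|].
      replace (Rpower t (x - 1) * / exp t * ((1 + Rpower t x) ^ 2 * exp t))
        with (Rpower t (x - 1) * (1 + Rpower t x) ^ 2) by (field; lra).
      replace (4 * Rpower t (x - 1) / (1 + Rpower t x) ^ 2 * ((1 + Rpower t x) ^ 2 * exp t))
        with (Rpower t (x - 1) * (4 * exp t)) by (field; lra).
      apply Rmult_le_compat_l; lra.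
    + unfold minus, plus, opp, H; simpl.
      assert (Ha := exp_pos (x * ln a)). assert (Hb := exp_pos (x * ln b)).
      assert (0 < / (1 + exp (x * ln b))) by (apply Rinv_0_lt_compat; lra).
      assert (/ (1 + exp (x * ln a)) < 1) by (rewrite <- Rinv_1 at 2; apply Rinv_lt_contravar; lra).
      assert (0 < 4 / x) by (apply Rdiv_lt_0_compat; lra).
      nra.
Qed.

Lemma filterlim_gamma_boundary_0 (x : R) : 0 < x ->
  filterlim (gamma_integrand (x + 1)) (at_right 0) (locally 0).
Proof.
  intros Hx. apply filterlim_locally. intros eps.
  (* The radius is [eps^(1/x)], below which [t^x < eps]; the factor [exp (- t)] only helps. *)
  exists (mkposreal _ (exp_pos (ln eps / x))). intros t Ht Ht0.
  assert (He := cond_pos eps).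
  unfold ball in *; simpl in *. unfold AbsRing_ball, abs, minus, plus, opp in *; simpl in *.
  apply Rabs_def2 in Ht.
  assert (H := gamma_integrand_pos (x + 1) t).
  replace (gamma_integrand (x + 1) t + - 0) with (gamma_integrand (x + 1) t) by ring.
  rewrite Rabs_pos_eq by lra. unfold gamma_integrand.
  replace (x + 1 - 1) with x by ring.
  assert (Rpower t x < eps).
  { unfold Rpower. rewrite <- (exp_ln eps) by easy. apply exp_increasing.
    assert (Hl : ln t < ln eps / x).
    { rewrite <- (ln_exp (ln eps / x)). apply ln_increasing; lra. }
    replace (ln eps) with (x * (ln eps / x)) by (field; lra).
    apply Rmult_lt_compat_l; lra. }
  assert (exp (- t) < 1) by (rewrite <- exp_0; apply exp_increasing; lra).
  assert (0 < Rpower t x) by apply exp_pos. assert (0 < exp (- t)) by apply exp_pos. nra.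
Qed.

(* [x ln t <= x ln (2 x) + t / 2], from [ln u <= u] at [u = t / (2 x)]. *)
Lemma filterlim_gamma_boundary_infty (x : R) : 0 < x ->
  filterlim (gamma_integrand (x + 1)) (Rbar_locally p_infty) (locally 0).
Proof.
  intros Hx. apply filterlim_locally. intros eps. assert (He := cond_pos eps).
  exists (Rmax 0 (2 * (x * ln (2 * x) - ln eps))). intros t Ht.
  assert (Ht0 := Rle_lt_trans _ _ _ (Rmax_l _ _) Ht).
  assert (Ht1 := Rle_lt_trans _ _ _ (Rmax_r _ _) Ht).
  unfold ball; simpl. unfold AbsRing_ball, abs, minus, plus, opp; simpl.
  assert (H := gamma_integrand_pos (x + 1) t).
  replace (gamma_integrand (x + 1) t + - 0) with (gamma_integrand (x + 1) t) by ring.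
  rewrite Rabs_pos_eq by lra. unfold gamma_integrand, Rpower.
  replace (x + 1 - 1) with x by ring.
  rewrite <- exp_plus, <- (exp_ln eps) by easy. apply exp_increasing.
  assert (Hu : 0 < t / (2 * x)) by (apply Rdiv_lt_0_compat; lra).
  assert (Hl : ln (t / (2 * x)) <= t / (2 * x)).
  { assert (H1 := exp_ineq1_le (ln (t / (2 * x)))). rewrite exp_ln in H1; lra. }
  assert (Hs : ln t = ln (t / (2 * x)) + ln (2 * x)).
  { rewrite <- ln_mult by lra. f_equal. field. lra. }
  assert (Hm : x * ln (t / (2 * x)) <= t / 2).
  { replace (t / 2) with (x * (t / (2 * x))) by (field; lra).
    apply Rmult_le_compat_l; lra. }
  rewrite Hs. lra.
Qed.

(** Eventually both endpoints are positive, so the whole interval avoids the singularity at 0. This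
    supplies the eventual hypotheses of the improper fundamental theorem of calculus. *)
Lemma filter_prod_pos_interval (P : R -> Prop) :
  (forall t, 0 < t -> P t) ->
  filter_prod (at_right 0) (Rbar_locally p_infty)
    (fun ab : R * R => forall t, Rmin (fst ab) (snd ab) <= t <= Rmax (fst ab) (snd ab) -> P t).
Proof.
  intros HP. apply (Filter_prod _ _ _ (fun a => 0 < a) (fun b => 0 < b)).
  - exists (mkposreal 1 Rlt_0_1). now intros y _ Hy.
  - now exists 0.
  - intros a b Ha Hb t Ht. apply HP. simpl in Ht.
    assert (0 < Rmin a b) by now apply Rmin_pos. lra.
Qed.

Lemma is_derive_gamma_integrand (x t : R) : 0 < t ->
  is_derive (gamma_integrand (x + 1)) t
    (x * gamma_integrand x t - gamma_integrand (x + 1) t).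
Proof.
  intros Ht. unfold gamma_integrand, Rpower. auto_derive; [easy|].
  replace (x + 1 - 1) with x by ring.
  replace ((x - 1) * ln t) with (x * ln t + - ln t) by ring.
  rewrite exp_plus, (exp_Ropp (ln t)), exp_ln by lra. field. lra.
Qed.

(** Integration by parts: [t^x exp (- t)] vanishes at both ends, so its derivative
    [x t^(x-1) exp (- t) - t^x exp (- t)] has improper integral 0. *)
Lemma is_RInt_gen_gamma_succ (x l : R) : 0 < x ->
  is_RInt_gen (gamma_integrand x) (at_right 0) (Rbar_locally p_infty) l ->
  is_RInt_gen (gamma_integrand (x + 1)) (at_right 0) (Rbar_locally p_infty) (x * l).
Proof.
  intros Hx Hl.
  assert (HD : is_RInt_gen (Derive (gamma_integrand (x + 1)))
                 (at_right 0) (Rbar_locally p_infty) (0 - 0)).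
  { apply is_RInt_gen_Derive.
    - apply (filter_prod_pos_interval (ex_derive (gamma_integrand (x + 1)))). intros t Ht.
      eexists. now apply is_derive_gamma_integrand.
    - apply (filter_prod_pos_interval (continuous (Derive (gamma_integrand (x + 1))))).
      intros t Ht.
      apply continuous_ext_loc with (fun t => x * gamma_integrand x t - gamma_integrand (x + 1) t).
      + exists (mkposreal t Ht). intros y Hy.
        unfold ball in Hy; simpl in Hy. unfold AbsRing_ball, abs, minus, plus, opp in Hy.
        simpl in Hy. apply Rabs_def2 in Hy. symmetry. apply is_derive_unique.
        apply is_derive_gamma_integrand. lra.
      + apply (continuous_minus (V := R_NormedModule)).
        * apply (continuous_scal_r (V := R_NormedModule)). now apply continuous_gamma_integrand.
        * now apply continuous_gamma_integrand.
    - now apply filterlim_gamma_boundary_0.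
    - now apply filterlim_gamma_boundary_infty. }
  replace (x * l) with (minus (scal x l) (0 - 0))
    by (unfold minus, plus, opp, scal; simpl; unfold mult; simpl; ring).
  apply (is_RInt_gen_ext (V := R_NormedModule))
    with (fun t => minus (scal x (gamma_integrand x t)) (Derive (gamma_integrand (x + 1)) t)).
  - eapply filter_imp; [| apply (filter_prod_pos_interval (fun t =>
      minus (scal x (gamma_integrand x t)) (Derive (gamma_integrand (x + 1)) t) =
      gamma_integrand (x + 1) t))].
    + intros [a b] H t Ht. apply H. simpl in *. lra.
    + intros t Ht. rewrite (is_derive_unique _ _ _ (is_derive_gamma_integrand x t Ht)).
      unfold minus, plus, opp, scal; simpl; unfold mult; simpl; ring.
  - apply (is_RInt_gen_minus (V := R_NormedModule)); [| easy].
    now apply (is_RInt_gen_scal (V := R_NormedModule)).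
Qed.

(** [Gamma] is total, so the functional equation is meaningful only together with convergence, which
    is carried along as a separate fact. *)
Definition Gamma_converges (x : R) : Prop :=
  is_RInt_gen (gamma_integrand x) (at_right 0) (Rbar_locally p_infty) (Gamma x).

Lemma Gamma_converges_small (x : R) : 0 < x <= 1 -> Gamma_converges x.
Proof.
  intros Hx. apply (RInt_gen_correct (V := R_CompleteNormedModule)).
  now apply ex_RInt_gen_gamma_small.
Qed.

(** Convergence passes from [x] to [x + 1], so integrability on [(0, 1]] reaches every later
    argument by induction. *)
Lemma Gamma_succ (x : R) : 0 < x -> Gamma_converges x ->
  Gamma_converges (x + 1) /\ Gamma (x + 1) = x * Gamma x.
Proof.
  intros Hx H. assert (H1 := is_RInt_gen_gamma_succ _ _ Hx H).
  assert (HG : Gamma (x + 1) = x * Gamma x)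
    by exact (is_RInt_gen_unique (V := R_CompleteNormedModule) _ _ H1).
  split; [| exact HG]. unfold Gamma_converges. rewrite HG. exact H1.
Qed.

Lemma Gamma_1 : Gamma 1 = 1.
Proof.
  unfold Gamma. apply (is_RInt_gen_unique (V := R_CompleteNormedModule)).
  assert (HD : forall t, is_derive (fun t => - exp (- t)) t (exp (- t))).
  { intros t. auto_derive; [easy | ring]. }
  assert (H : is_RInt_gen (Derive (fun t => - exp (- t)))
                (at_right 0) (Rbar_locally p_infty) (0 - -1)).
  { apply is_RInt_gen_Derive.
    - apply (filter_prod_pos_interval (ex_derive (fun t => - exp (- t)))).
      intros t _. exists (exp (- t)). apply HD.
    - apply (filter_prod_pos_interval (continuous (Derive (fun t => - exp (- t))))).
      intros t _. apply continuous_ext with (fun t => exp (- t)).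
      + intros u. symmetry. apply is_derive_unique, HD.
      + apply (ex_derive_continuous (V := R_NormedModule)). auto_derive. exact I.
    - replace (-1) with (- exp (- 0)) by (rewrite Ropp_0, exp_0; ring).
      assert (Hc : continuous (fun t => - exp (- t)) 0).
      { apply (ex_derive_continuous (V := R_NormedModule)). auto_derive. exact I. }
      intros P HP. destruct (Hc P HP) as [d Hd]. exists d. intros y Hy _. exact (Hd y Hy).
    - apply filterlim_locally. intros eps. assert (He := cond_pos eps).
      exists (- ln eps). intros t Ht. unfold ball; simpl.
      unfold AbsRing_ball, abs, minus, plus, opp; simpl.
      assert (H1 : exp (- t) < eps).
      { rewrite <- (exp_ln eps) by easy. apply exp_increasing. lra. }
      assert (H2 := exp_pos (- t)). apply Rabs_def1; lra. }
  replace (0 - -1) with 1 in H by ring.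
  revert H. apply (is_RInt_gen_ext (V := R_NormedModule)).
  eapply filter_imp; [| apply (filter_prod_pos_interval (fun t =>
    Derive (fun t => - exp (- t)) t = Rpower t (1 - 1) * exp (- t)))].
  - intros [a b] H t Ht. apply H. simpl in *. lra.
  - intros t Ht. replace (1 - 1) with 0 by ring. rewrite Rpower_O, Rmult_1_l by easy.
    apply is_derive_unique, HD.
Qed.

Lemma Gamma_nat (m : nat) : Gamma_converges (INR m + 1) /\ 0 < Gamma (INR m + 1).
Proof.
  induction m as [|m [Hc IH]].
  - simpl. rewrite Rplus_0_l. split; [apply Gamma_converges_small | rewrite Gamma_1]; lra.
  - rewrite S_INR. assert (Hm := pos_INR m).
    destruct (Gamma_succ (INR m + 1)) as [H1 H2]; [lra | easy |].
    split; [easy|]. rewrite H2. apply Rmult_lt_0_compat; lra.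
Qed.

(** * Generalized binomial coefficients *)

Fixpoint gbinom (s : R) (i : nat) : R :=
  match i with
  | O => 1
  | S i' => gbinom s i' * (s - INR i') / (INR i' + 1)
  end.

Lemma gbinom_pascal (s : R) (i : nat) :
  gbinom s (S i) = gbinom (s - 1) (S i) + gbinom (s - 1) i.
Proof.
  induction i as [|i IH].
  - simpl. field.
  - change (gbinom s (S (S i))) with (gbinom s (S i) * (s - INR (S i)) / (INR (S i) + 1)).
    rewrite IH. cbn [gbinom]. rewrite !S_INR. assert (Hi := pos_INR i). field. lra.
Qed.

(** By Pascal's rule each summand is a difference of consecutive values of the right-hand side, so
    the sum telescopes. *)
Lemma sum_alternating_gbinom (s : R) (N : nat) :
  sum_n (fun i => (-1) ^ i * gbinom s i) N = (-1) ^ N * gbinom (s - 1) N.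
Proof.
  induction N as [|N IH].
  - now rewrite sum_O.
  - rewrite sum_Sn, IH, (gbinom_pascal s N). unfold plus; simpl. ring.
Qed.

Lemma alternating_gbinom_pos (s : R) (i : nat) : s < 1 ->
  0 < (-1) ^ i * gbinom (s - 1) i.
Proof.
  intros Hs. induction i as [|i IH].
  - simpl. lra.
  - assert (Hi := pos_INR i). cbn [pow gbinom].
    replace (-1 * (-1) ^ i * (gbinom (s - 1) i * (s - 1 - INR i) / (INR i + 1)))
      with ((-1) ^ i * gbinom (s - 1) i * ((INR i + 1 - s) / (INR i + 1))) by (field; lra).
    apply Rmult_lt_0_compat; [exact IH|]. apply Rdiv_lt_0_compat; lra.
Qed.

(** The bound is [(i + 1)^(-s)]. The ratio of consecutive terms is
    [1 - s / (i + 1) <= exp (- s / (i + 1))], and [ln (i + 2) - ln (i + 1) <= 1 / (i + 1)]. *)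
Lemma alternating_gbinom_le (s : R) (i : nat) : 0 < s < 1 ->
  (-1) ^ i * gbinom (s - 1) i <= exp (- s * ln (INR i + 1)).
Proof.
  intros Hs. induction i as [|i IH].
  - simpl. rewrite Rplus_0_l, ln_1, Rmult_0_r, exp_0. lra.
  - assert (Hi := pos_INR i). assert (Hd := alternating_gbinom_pos s i (proj2 Hs)).
    rewrite S_INR. cbn [pow gbinom].
    replace (-1 * (-1) ^ i * (gbinom (s - 1) i * (s - 1 - INR i) / (INR i + 1)))
      with ((-1) ^ i * gbinom (s - 1) i * (1 + - s / (INR i + 1))) by (field; lra).
    set (v := 1 / (INR i + 1)).
    assert (Hv : 0 < v) by (apply Rdiv_lt_0_compat; lra).
    assert (Hl : ln (INR i + 1 + 1) <= ln (INR i + 1) + v).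
    { replace (INR i + 1 + 1) with ((INR i + 1) * (1 + v)) by (unfold v; field; lra).
      rewrite ln_mult by lra. apply Rplus_le_compat_l.
      rewrite <- (ln_exp v) at 2. apply ln_le; [lra | apply exp_ineq1_le]. }
    assert (He := exp_ineq1_le (- s / (INR i + 1))).
    apply Rle_trans with (exp (- s * ln (INR i + 1)) * exp (- s / (INR i + 1))).
    + apply Rle_trans with ((-1) ^ i * gbinom (s - 1) i * exp (- s / (INR i + 1))).
      * apply Rmult_le_compat_l; lra.
      * apply Rmult_le_compat_r; [apply Rlt_le, exp_pos | exact IH].
    + rewrite <- exp_plus.
      assert (- s * ln (INR i + 1) + - s / (INR i + 1) <= - s * ln (INR i + 1 + 1)).
      { replace (- s / (INR i + 1)) with (- s * v) by (unfold v; field; lra). nra. }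
      destruct H as [H|H]; [now apply Rlt_le, exp_increasing | rewrite H; apply Rle_refl].
Qed.

Lemma is_lim_seq_alternating_gbinom (s : R) : 0 < s < 1 ->
  is_lim_seq (fun i => (-1) ^ i * gbinom (s - 1) i) 0.
Proof.
  intros Hs. apply is_lim_seq_spec. intros eps. assert (He := cond_pos eps).
  (* The threshold is [eps^(-1/s)], beyond which [(i + 1)^(-s) < eps]. *)
  destruct (INR_unbounded (exp (- ln eps / s))) as [N HN]. exists N. intros i Hi.
  assert (Hd := alternating_gbinom_pos s i (proj2 Hs)).
  assert (Hle := alternating_gbinom_le s i Hs).
  rewrite Rminus_0_r, Rabs_pos_eq by lra. apply Rle_lt_trans with (1 := Hle).
  rewrite <- (exp_ln eps) by easy. apply exp_increasing.
  assert (H : - ln eps / s < ln (INR i + 1)).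
  { rewrite <- (ln_exp (- ln eps / s)). apply le_INR in Hi.
    apply ln_increasing; [apply exp_pos | lra]. }
  apply Rmult_lt_compat_l with (r := s) in H; [| lra].
  replace (s * (- ln eps / s)) with (- ln eps) in H by (field; lra). lra.
Qed.

(** This is the value of [(1 + z)^s] at [z = -1]. It is read off the partial sums because the
    argument of [1 + z] used for the other points breaks down there. *)
Lemma is_series_alternating_gbinom (s : R) : 0 < s < 1 ->
  is_series (fun i => (-1) ^ i * gbinom s i) 0.
Proof.
  intros Hs. apply (is_lim_seq_ext (fun N => (-1) ^ N * gbinom (s - 1) N)
    (sum_n (fun i => (-1) ^ i * gbinom s i)) (Finite 0)).
  - intros N. symmetry. apply sum_alternating_gbinom.
  - now apply is_lim_seq_alternating_gbinom.
Qed.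

(** With [d i = (-1)^i * gbinom (s - 1) i], Pascal's rule gives [d i - d (S i)] up to sign, and this
    equals [d i * s / (i + 1) > 0]. The absolute values therefore telescope. *)
Lemma Rabs_gbinom_succ (s : R) (i : nat) : 0 < s < 1 ->
  Rabs (gbinom s (S i)) =
  (-1) ^ i * gbinom (s - 1) i - (-1) ^ S i * gbinom (s - 1) (S i).
Proof.
  intros Hs. assert (Hi := pos_INR i). assert (Hd := alternating_gbinom_pos s i (proj2 Hs)).
  replace (Rabs (gbinom s (S i))) with (Rabs ((-1) ^ i * gbinom s (S i)))
    by (rewrite Rabs_mult, pow_1_abs; apply Rmult_1_l).
  assert (H : (-1) ^ i * gbinom s (S i) =
    (-1) ^ i * gbinom (s - 1) i - (-1) ^ S i * gbinom (s - 1) (S i)).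
  { rewrite gbinom_pascal. simpl. ring. }
  rewrite H. apply Rabs_pos_eq. cbn [pow gbinom].
  replace ((-1) ^ i * gbinom (s - 1) i -
    -1 * (-1) ^ i * (gbinom (s - 1) i * (s - 1 - INR i) / (INR i + 1)))
    with ((-1) ^ i * gbinom (s - 1) i * (s / (INR i + 1))) by (field; lra).
  apply Rlt_le, Rmult_lt_0_compat; [exact Hd|]. apply Rdiv_lt_0_compat; lra.
Qed.

Lemma ex_series_Rabs_gbinom (s : R) : 0 < s < 1 ->
  ex_series (fun i => Rabs (gbinom s i)).
Proof.
  (* The term of index 0 gives 1, and the others telescope to [1 - (-1)^N * gbinom (s - 1) N], whose
     limit is 1. *)
  intros Hs. exists (2 - 0).
  apply (is_lim_seq_ext (fun N => 2 - (-1) ^ N * gbinom (s - 1) N)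
    (sum_n (fun i => Rabs (gbinom s i))) (Finite (2 - 0))).
  - induction n as [|N IH].
    + rewrite sum_O. simpl. rewrite Rabs_R1. ring.
    + rewrite sum_Sn, <- IH, (Rabs_gbinom_succ s N Hs). unfold plus; simpl. ring.
  - apply is_lim_seq_minus'; [apply is_lim_seq_const | now apply is_lim_seq_alternating_gbinom].
Qed.

(** Both sides gain the factor [(i + alpha) / (i + 1)] when [i] increases by one. Convergence is
    part of the induction since [Gamma_succ] asks for it. *)
Lemma Gamma_quotient (alpha : R) (i : nat) : 0 < alpha <= 1 ->
  Gamma_converges (INR i + alpha) /\
  Gamma (INR i + alpha) / Gamma (INR i + 1) = Gamma alpha * ((-1) ^ i * gbinom (- alpha) i).
Proof.
  intros Ha. induction i as [|i [Hc IH]].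
  - simpl. rewrite !Rplus_0_l, Gamma_1. split; [now apply Gamma_converges_small | field].
  - rewrite !S_INR. assert (Hi := pos_INR i).
    destruct (Gamma_succ (INR i + alpha)) as [H1 H2]; [lra | easy |].
    replace (INR i + 1 + alpha) with (INR i + alpha + 1) by ring. split; [easy|].
    destruct (Gamma_nat i) as [H3 H4].
    destruct (Gamma_succ (INR i + 1)) as [_ H5]; [lra | easy |].
    rewrite H2, H5. cbn [pow gbinom].
    transitivity (Gamma (INR i + alpha) / Gamma (INR i + 1) * ((INR i + alpha) / (INR i + 1))).
    + field. lra.
    + rewrite IH. field. lra.
Qed.

Lemma U_succ (alpha : R) (i : nat) : 0 < alpha < 1 ->
  U alpha (Z.of_nat i + 1) = Gamma alpha * ((-1) ^ i * gbinom (- alpha) i).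
Proof.
  intros Ha. unfold U. destruct (Z_le_dec 1 (Z.of_nat i + 1)) as [_|H]; [| lia].
  rewrite plus_IZR, <- INR_IZR_INZ.
  replace (INR i + 1 + alpha - 1) with (INR i + alpha) by ring.
  apply Gamma_quotient. lra.
Qed.

(** Differencing coefficients multiplies the generating function [(1 - z)^(-alpha)] by [1 - z]; on
    coefficients this is Pascal's rule. *)
Lemma S_term_gbinom (alpha : R) (p l k : nat) : 0 < alpha < 1 -> (1 <= p)%nat ->
  S_term alpha p l k =
  - Gamma alpha * ((-1) ^ (l * k + (p - 1)) * gbinom (1 - alpha) (l * k + (p - 1))).
Proof.
  intros Ha Hp. unfold S_term.
  replace (Z.of_nat l * Z.of_nat k + Z.of_nat p)%Z
    with (Z.of_nat (l * k + (p - 1)) + 1)%Z by nia.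
  rewrite U_succ by easy. rewrite Z.add_simpl_r.
  (* At index 0 the term is [U alpha 0 - U alpha 1], and [U alpha 0 = 0] by convention agrees with
     [gbinom _ 0 = 1]. *)
  destruct (l * k + (p - 1))%nat as [|i].
  - unfold U. simpl. ring.
  - rewrite Nat2Z.inj_succ. unfold Z.succ. rewrite U_succ, (gbinom_pascal (1 - alpha)) by easy.
    replace (1 - alpha - 1) with (- alpha) by ring. cbn [pow]. ring.
Qed.

(** * The binomial series on the unit circle *)

Lemma CV_radius_ge_1 (a : nat -> R) :
  ex_series (fun i => Rabs (a i)) -> Rbar_le 1 (CV_radius a).
Proof.
  intros H. apply (proj1 (Lub_Rbar_correct (CV_disk a)) 1).
  unfold CV_disk. revert H. apply ex_series_ext. intros i. now rewrite pow1, Rmult_1_r.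
Qed.

(** Absolute summability only gives a radius of at least 1. If it exceeds 1, the sum is continuous
    at 1; if it equals 1, Abel's theorem applies. *)
Lemma filterlim_PSeries_1 (a : nat -> R) :
  ex_series (fun i => Rabs (a i)) ->
  filterlim (PSeries a) (at_left 1) (locally (Series a)).
Proof.
  intros H.
  replace (Series a) with (PSeries a 1).
  2: { apply Series_ext. intros i. now rewrite pow1, Rmult_1_r. }
  assert (Hr := CV_radius_ge_1 a H).
  destruct (Rbar_le_lt_or_eq_dec _ _ Hr) as [Hlt | Heq].
  - assert (Hc : continuity_pt (PSeries a) 1).
    { apply PSeries_continuity. now rewrite Rabs_R1. }
    apply continuity_pt_filterlim in Hc. intros P HP. destruct (Hc P HP) as [d Hd].
    exists d. intros y Hy _. exact (Hd y Hy).
  - assert (HA := Abel a). rewrite <- Heq in HA. apply HA.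
    + exact Rlt_0_1.
    + exact I.
    + apply ex_series_Rabs. revert H. apply ex_series_ext. intros i.
      rewrite pow_n_pow, pow1. unfold scal; simpl; unfold mult; simpl. now rewrite Rmult_1_l.
Qed.

Lemma PSeries_index_mult (a : nat -> R) (r : R) :
  PSeries (fun i => INR i * a i) r = r * PSeries (PS_derive a) r.
Proof.
  rewrite <- PSeries_incr_1. apply PSeries_ext. intros [|i]; simpl.
  - unfold zero; simpl. ring.
  - reflexivity.
Qed.

(** Coefficientwise form of [e' = u (s a - r a') + v (s b - r b')]. The angle addition formulas put
    the cosine and sine series in this shape. *)
Lemma PSeries_derive_binomial_recurrence (a b e : nat -> R) (u v s r : R) :
  (forall i, INR (S i) * e (S i) = (s - INR i) * (u * a i + v * b i)) ->
  Rbar_lt (Rabs r) (CV_radius a) -> Rbar_lt (Rabs r) (CV_radius b) ->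
  PSeries (PS_derive e) r =
  u * (s * PSeries a r - r * PSeries (PS_derive a) r) +
  v * (s * PSeries b r - r * PSeries (PS_derive b) r).
Proof.
  intros He Ha Hb.
  assert (Hea := CV_radius_inside _ _ Ha). assert (Heb := CV_radius_inside _ _ Hb).
  assert (Hex : forall c, Rbar_lt (Rabs r) (CV_radius c) ->
    ex_pseries (fun i => INR i * c i) r).
  { intros c Hc. apply (ex_pseries_ext (PS_incr_1 (PS_derive c))).
    - intros [|i]; simpl; [unfold zero; simpl; ring | reflexivity].
    - now apply ex_pseries_incr_1, ex_pseries_derive. }
  rewrite <- !PSeries_index_mult.
  apply is_pseries_unique.
  apply (is_pseries_ext (PS_plus
    (PS_scal u (PS_minus (PS_scal s a) (fun i => INR i * a i)))
    (PS_scal v (PS_minus (PS_scal s b) (fun i => INR i * b i))))).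
  - intros i. unfold PS_derive. rewrite He.
    unfold PS_plus, PS_minus, PS_scal, PS_plus, PS_opp, plus, opp, scal; simpl.
    unfold mult; simpl. ring.
  - apply (is_pseries_plus (V := R_NormedModule)).
    + apply (is_pseries_scal (V := R_NormedModule)); [apply Rmult_comm |].
      apply (is_pseries_minus (V := R_NormedModule)).
      * apply (is_pseries_scal (V := R_NormedModule)); [apply Rmult_comm |].
        now apply PSeries_correct.
      * apply PSeries_correct, Hex, Ha.
    + apply (is_pseries_scal (V := R_NormedModule)); [apply Rmult_comm |].
      apply (is_pseries_minus (V := R_NormedModule)).
      * apply (is_pseries_scal (V := R_NormedModule)); [apply Rmult_comm |].
        now apply PSeries_correct.
      * apply PSeries_correct, Hex, Hb.
Qed.

(* With [w = C + i D] and [v = E exp (- i s phi)], the hypotheses say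
   [w' = s (lam + i mu) w] and [v' = - s (lam + i mu) v], so that [w v] is constant. *)
Lemma rotation_ode (C D E phi lam mu : R -> R) (s r : R) :
  0 < r ->
  (forall t, 0 <= t <= r -> is_derive C t (s * (lam t * C t - mu t * D t))) ->
  (forall t, 0 <= t <= r -> is_derive D t (s * (lam t * D t + mu t * C t))) ->
  (forall t, 0 <= t <= r -> is_derive E t (- s * lam t * E t)) ->
  (forall t, 0 <= t <= r -> is_derive phi t (mu t)) ->
  C 0 = 1 -> D 0 = 0 -> E 0 = 1 -> phi 0 = 0 ->
  E r * C r = cos (s * phi r) /\ E r * D r = sin (s * phi r).
Proof.
  intros Hr HC HD HE Hphi C0 D0 E0 phi0.
  assert (H1 : E 0 * (C 0 * cos (s * phi 0) + D 0 * sin (s * phi 0)) =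
               E r * (C r * cos (s * phi r) + D r * sin (s * phi r))).
  { apply (eq_is_derive (V := R_NormedModule)
      (fun t => E t * (C t * cos (s * phi t) + D t * sin (s * phi t)))); [| exact Hr].
    intros t Ht. specialize (HC t Ht). specialize (HD t Ht).
    specialize (HE t Ht). specialize (Hphi t Ht).
    auto_derive.
    - repeat split; eexists; eassumption.
    - rewrite (is_derive_unique (fun x : R => C x) _ _ HC),
        (is_derive_unique (fun x : R => D x) _ _ HD),
        (is_derive_unique (fun x : R => E x) _ _ HE),
        (is_derive_unique (fun x : R => phi x) _ _ Hphi).
      unfold zero; simpl. ring. }
  assert (H2 : E 0 * (D 0 * cos (s * phi 0) - C 0 * sin (s * phi 0)) =
               E r * (D r * cos (s * phi r) - C r * sin (s * phi r))).
  { apply (eq_is_derive (V := R_NormedModule)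
      (fun t => E t * (D t * cos (s * phi t) - C t * sin (s * phi t)))); [| exact Hr].
    intros t Ht. specialize (HC t Ht). specialize (HD t Ht).
    specialize (HE t Ht). specialize (Hphi t Ht).
    auto_derive.
    - repeat split; eexists; eassumption.
    - rewrite (is_derive_unique (fun x : R => C x) _ _ HC),
        (is_derive_unique (fun x : R => D x) _ _ HD),
        (is_derive_unique (fun x : R => E x) _ _ HE),
        (is_derive_unique (fun x : R => phi x) _ _ Hphi).
      unfold zero; simpl. ring. }
  rewrite C0, D0, E0, phi0, Rmult_0_r, cos_0, sin_0 in H1, H2.
  assert (Hp := sin2_cos2 (s * phi r)). unfold Rsqr in Hp.
  set (c := cos (s * phi r)) in *. set (d := sin (s * phi r)) in *.
  (* Both conserved quantities, the real and imaginary parts of [w v], are now known to be 1 and 0.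
     Multiplying back by [exp (i s phi)] isolates [E w], and the last summand of each identity
     vanishes by [Hp]. *)
  split.
  - transitivity (c * (E r * (C r * c + D r * d)) - d * (E r * (D r * c - C r * d))
      + E r * C r * (1 - (d * d + c * c))); [ring|]. rewrite <- H1, <- H2, Hp. ring.
  - transitivity (d * (E r * (C r * c + D r * d)) + c * (E r * (D r * c - C r * d))
      + E r * D r * (1 - (d * d + c * c))); [ring|]. rewrite <- H1, <- H2, Hp. ring.
Qed.

(** With [gbinom_sin], the real and imaginary parts of the coefficient of [r^i] in
    [(1 + r exp (i x))^s]. *)
Definition gbinom_cos (s x : R) (i : nat) : R := gbinom s i * cos (INR i * x).
Definition gbinom_sin (s x : R) (i : nat) : R := gbinom s i * sin (INR i * x).

Lemma ex_series_Rabs_gbinom_cos (s x : R) : 0 < s < 1 ->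
  ex_series (fun i => Rabs (gbinom_cos s x i)).
Proof.
  intros Hs. apply (ex_series_le (V := R_CompleteNormedModule) _ (fun i => Rabs (gbinom s i)));
    [| now apply ex_series_Rabs_gbinom].
  intros i. unfold norm; simpl. unfold abs; simpl. rewrite Rabs_Rabsolu. unfold gbinom_cos.
  rewrite Rabs_mult. assert (H : Rabs (cos (INR i * x)) <= 1) by (apply Rabs_le, COS_bound).
  assert (H1 := Rabs_pos (gbinom s i)). nra.
Qed.

Lemma ex_series_Rabs_gbinom_sin (s x : R) : 0 < s < 1 ->
  ex_series (fun i => Rabs (gbinom_sin s x i)).
Proof.
  intros Hs. apply (ex_series_le (V := R_CompleteNormedModule) _ (fun i => Rabs (gbinom s i)));
    [| now apply ex_series_Rabs_gbinom].
  intros i. unfold norm; simpl. unfold abs; simpl. rewrite Rabs_Rabsolu. unfold gbinom_sin.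
  rewrite Rabs_mult. assert (H : Rabs (sin (INR i * x)) <= 1) by (apply Rabs_le, SIN_bound).
  assert (H1 := Rabs_pos (gbinom s i)). nra.
Qed.

Lemma gbinom_succ_mult (s : R) (i : nat) :
  INR (S i) * gbinom s (S i) = (s - INR i) * gbinom s i.
Proof.
  rewrite S_INR. assert (Hi := pos_INR i). simpl gbinom. field. lra.
Qed.

(* Real part, imaginary part, squared modulus and argument of [1 + r exp (i x)]. *)
Definition one_plus_re (x r : R) : R := 1 + r * cos x.
Definition one_plus_im (x r : R) : R := r * sin x.
Definition one_plus_sq (x r : R) : R := one_plus_re x r ^ 2 + one_plus_im x r ^ 2.
Definition one_plus_arg (x r : R) : R := atan (one_plus_im x r / one_plus_re x r).

Lemma one_plus_re_pos (x r : R) : Rabs r < 1 -> 0 < one_plus_re x r.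
Proof.
  intros Hr. assert (H : Rabs (cos x) <= 1) by apply Rabs_le, COS_bound.
  assert (Hm : Rabs (r * cos x) < 1).
  { rewrite Rabs_mult. assert (H1 := Rabs_pos r). assert (H2 := Rabs_pos (cos x)). nra. }
  apply Rabs_def2 in Hm. unfold one_plus_re. lra.
Qed.

Lemma one_plus_sq_pos (x r : R) : 0 < one_plus_re x r -> 0 < one_plus_sq x r.
Proof. intros H. unfold one_plus_sq. nra. Qed.

(** Here [lam + i mu = exp (i x) / (1 + r exp (i x))], so the claim is [w' = s (lam + i mu) w] for
    [w = C + i D]. *)
Lemma is_derive_gbinom_trig (s x r : R) : 0 < s < 1 -> Rabs r < 1 ->
  let C := PSeries (gbinom_cos s x) in
  let D := PSeries (gbinom_sin s x) in
  let lam := (one_plus_re x r * cos x + one_plus_im x r * sin x) / one_plus_sq x r in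
  let mu := (one_plus_re x r * sin x - one_plus_im x r * cos x) / one_plus_sq x r in
  is_derive C r (s * (lam * C r - mu * D r)) /\
  is_derive D r (s * (lam * D r + mu * C r)).
Proof.
  intros Hs Hr C D lam mu.
  assert (HrC : Rbar_lt (Rabs r) (CV_radius (gbinom_cos s x))).
  { apply Rbar_lt_le_trans with 1; [exact Hr |].
    now apply CV_radius_ge_1, ex_series_Rabs_gbinom_cos. }
  assert (HrD : Rbar_lt (Rabs r) (CV_radius (gbinom_sin s x))).
  { apply Rbar_lt_le_trans with 1; [exact Hr |].
    now apply CV_radius_ge_1, ex_series_Rabs_gbinom_sin. }
  assert (HC := is_derive_PSeries _ _ HrC). assert (HD := is_derive_PSeries _ _ HrD).
  fold C in HC. fold D in HD.
  set (C' := PSeries (PS_derive (gbinom_cos s x)) r) in *.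
  set (D' := PSeries (PS_derive (gbinom_sin s x)) r) in *.
  assert (EC : C' = cos x * (s * C r - r * C') + (- sin x) * (s * D r - r * D')).
  { apply PSeries_derive_binomial_recurrence; [| easy | easy].
    intros i. unfold gbinom_cos, gbinom_sin. rewrite <- Rmult_assoc, gbinom_succ_mult.
    rewrite S_INR, Rmult_plus_distr_r, Rmult_1_l, cos_plus. ring. }
  assert (ED : D' = sin x * (s * C r - r * C') + cos x * (s * D r - r * D')).
  { apply PSeries_derive_binomial_recurrence; [| easy | easy].
    intros i. unfold gbinom_cos, gbinom_sin. rewrite <- Rmult_assoc, gbinom_succ_mult.
    rewrite S_INR, Rmult_plus_distr_r, Rmult_1_l, sin_plus. ring. }
  assert (Hq := one_plus_sq_pos x r (one_plus_re_pos x r Hr)).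
  (* [E1] and [E2] are the real and imaginary parts of [(1 + r exp (i x)) w' = s exp (i x) w];
     multiplying by the conjugate of [1 + r exp (i x)] then solves for [w']. *)
  assert (E1 : one_plus_re x r * C' - one_plus_im x r * D' = s * (cos x * C r - sin x * D r)).
  { unfold one_plus_re, one_plus_im. lra. }
  assert (E2 : one_plus_im x r * C' + one_plus_re x r * D' = s * (sin x * C r + cos x * D r)).
  { unfold one_plus_re, one_plus_im. lra. }
  split.
  - replace (s * (lam * C r - mu * D r)) with C'; [exact HC|].
    apply Rmult_eq_reg_l with (one_plus_sq x r); [| lra].
    transitivity (one_plus_re x r * (s * (cos x * C r - sin x * D r))
      + one_plus_im x r * (s * (sin x * C r + cos x * D r))).
    + rewrite <- E1, <- E2. unfold one_plus_sq. ring.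
    + unfold lam, mu. field. lra.
  - replace (s * (lam * D r + mu * C r)) with D'; [exact HD|].
    apply Rmult_eq_reg_l with (one_plus_sq x r); [| lra].
    transitivity (one_plus_re x r * (s * (sin x * C r + cos x * D r))
      - one_plus_im x r * (s * (cos x * C r - sin x * D r))).
    + rewrite <- E1, <- E2. unfold one_plus_sq. ring.
    + unfold lam, mu. field. lra.
Qed.

Lemma PSeries_gbinom_trig (s x r : R) : 0 < s < 1 -> 0 < r < 1 ->
  PSeries (gbinom_cos s x) r =
    exp (s / 2 * ln (one_plus_sq x r)) * cos (s * one_plus_arg x r) /\
  PSeries (gbinom_sin s x) r =
    exp (s / 2 * ln (one_plus_sq x r)) * sin (s * one_plus_arg x r).
Proof.
  intros Hs Hr.
  assert (Ht1 : forall t, 0 <= t <= r -> Rabs t < 1).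
  { intros t Ht. rewrite Rabs_pos_eq; lra. }
  (* The third function is the modulus of [1 + t exp (i x)] to the power [-s]. The logarithm of that
     modulus has derivative [lam], and the argument has derivative [mu]. *)
  destruct (rotation_ode (PSeries (gbinom_cos s x)) (PSeries (gbinom_sin s x))
    (fun t => exp (- (s / 2 * ln (one_plus_sq x t)))) (one_plus_arg x)
    (fun t => (one_plus_re x t * cos x + one_plus_im x t * sin x) / one_plus_sq x t)
    (fun t => (one_plus_re x t * sin x - one_plus_im x t * cos x) / one_plus_sq x t)
    s r) as [H1 H2].
  - easy.
  - intros t Ht. apply is_derive_gbinom_trig; [easy | now apply Ht1].
  - intros t Ht. apply is_derive_gbinom_trig; [easy | now apply Ht1].
  - intros t Ht. assert (Hq := one_plus_sq_pos x t (one_plus_re_pos x t (Ht1 t Ht))).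
    unfold one_plus_sq, one_plus_re, one_plus_im in *.
    auto_derive; [lra|]. cbn [pow] in *. field. lra.
  - intros t Ht. assert (Hp := one_plus_re_pos x t (Ht1 t Ht)).
    assert (Hq := one_plus_sq_pos x t Hp).
    unfold one_plus_arg, one_plus_sq, one_plus_re, one_plus_im in *. auto_derive; [lra|].
    unfold Rsqr. field. lra.
  - rewrite PSeries_0. unfold gbinom_cos. simpl. rewrite Rmult_0_l, cos_0. ring.
  - rewrite PSeries_0. unfold gbinom_sin. simpl. rewrite Rmult_0_l, sin_0. ring.
  - unfold one_plus_sq, one_plus_re, one_plus_im.
    replace ((1 + 0 * cos x) ^ 2 + (0 * sin x) ^ 2) with 1 by ring.
    rewrite ln_1, Rmult_0_r, Ropp_0. apply exp_0.
  - unfold one_plus_arg, one_plus_im. rewrite Rmult_0_l.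
    unfold Rdiv. rewrite Rmult_0_l. apply atan_0.
  - rewrite exp_Ropp in H1, H2. assert (He := exp_pos (s / 2 * ln (one_plus_sq x r))).
    rewrite <- H1, <- H2. split; field; lra.
Qed.

(** * Boundary values of the binomial series *)

Lemma one_plus_re_1_pos (x : R) : 0 <= x < PI -> 0 < one_plus_re x 1.
Proof.
  intros Hx. unfold one_plus_re. rewrite Rmult_1_l.
  assert (H := cos_decreasing_1 x PI). rewrite cos_PI in H. lra.
Qed.

Lemma one_plus_sq_1 (x : R) : one_plus_sq x 1 = (2 * cos (x / 2)) ^ 2.
Proof.
  unfold one_plus_sq, one_plus_re, one_plus_im. assert (H := sin2_cos2 x). unfold Rsqr in H.
  replace (cos x) with (2 * cos (x / 2) * cos (x / 2) - 1) in *
    by (rewrite <- cos_2a_cos; f_equal; field). nra.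
Qed.

Lemma one_plus_arg_1 (x : R) : 0 <= x < PI -> one_plus_arg x 1 = x / 2.
Proof.
  intros Hx. rewrite <- (atan_tan (x / 2)) by lra. unfold one_plus_arg. f_equal.
  assert (Hc : 0 < cos (x / 2)) by (apply cos_gt_0; lra).
  unfold one_plus_re, one_plus_im, tan. rewrite !Rmult_1_l.
  replace (cos x) with (2 * cos (x / 2) * cos (x / 2) - 1)
    by (rewrite <- cos_2a_cos; f_equal; field).
  replace (sin x) with (2 * sin (x / 2) * cos (x / 2))
    by (rewrite <- sin_2a; f_equal; field).
  field. nra.
Qed.

(** The power series tends to [Series a] from the left of 1, and its closed form tends to [F 1];
    limits are unique. *)
Lemma is_series_at_left_1 (a : nat -> R) (F : R -> R) :
  ex_series (fun i => Rabs (a i)) -> continuous F 1 ->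
  (forall r, 0 < r < 1 -> PSeries a r = F r) -> is_series a (F 1).
Proof.
  intros Ha HF Heq. replace (F 1) with (Series a).
  { apply Series_correct. now apply ex_series_Rabs. }
  apply (filterlim_locally_unique (F := at_left 1) (PSeries a)).
  - now apply filterlim_PSeries_1.
  - apply filterlim_ext_loc with F.
    + exists (mkposreal 1 Rlt_0_1). intros y Hy Hy1. symmetry. apply Heq.
      unfold ball in Hy; simpl in Hy. unfold AbsRing_ball, abs, minus, plus, opp in Hy.
      simpl in Hy. apply Rabs_def2 in Hy. lra.
    + intros P HP. destruct (HF P HP) as [d Hd]. exists d. intros y Hy _. exact (Hd y Hy).
Qed.

Lemma is_series_gbinom_trig (s x : R) : 0 < s < 1 -> 0 <= x < PI ->
  is_series (gbinom_cos s x) (Rpower (2 * cos (x / 2)) s * cos (s * (x / 2))) /\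
  is_series (gbinom_sin s x) (Rpower (2 * cos (x / 2)) s * sin (s * (x / 2))).
Proof.
  intros Hs Hx. assert (Hp := one_plus_re_1_pos x Hx). assert (Hq := one_plus_sq_pos x 1 Hp).
  assert (Hc : 0 < cos (x / 2)) by (apply cos_gt_0; lra).
  replace (Rpower (2 * cos (x / 2)) s) with (exp (s / 2 * ln (one_plus_sq x 1))).
  2: { unfold Rpower. f_equal. rewrite one_plus_sq_1, <- Rpower_pow by lra.
       unfold Rpower. rewrite ln_exp. simpl INR. field. }
  rewrite <- (one_plus_arg_1 x Hx).
  split.
  - apply (is_series_at_left_1 _
      (fun r => exp (s / 2 * ln (one_plus_sq x r)) * cos (s * one_plus_arg x r))).
    + now apply ex_series_Rabs_gbinom_cos.
    + apply (ex_derive_continuous (V := R_NormedModule)).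
      unfold one_plus_arg, one_plus_sq, one_plus_re, one_plus_im in *. auto_derive. lra.
    + intros r Hr. now apply PSeries_gbinom_trig.
  - apply (is_series_at_left_1 _
      (fun r => exp (s / 2 * ln (one_plus_sq x r)) * sin (s * one_plus_arg x r))).
    + now apply ex_series_Rabs_gbinom_sin.
    + apply (ex_derive_continuous (V := R_NormedModule)).
      unfold one_plus_arg, one_plus_sq, one_plus_re, one_plus_im in *. auto_derive. lra.
    + intros r Hr. now apply PSeries_gbinom_trig.
Qed.

(** Real part of the series times [exp (i psi)]; the phase will carry the weight [exp (- i r x)]
    that selects the residue [r]. *)
Lemma is_series_gbinom_cos_shift (s x psi : R) : 0 < s < 1 -> 0 <= x < PI ->
  is_series (fun i => gbinom s i * cos (INR i * x + psi))
    (Rpower (2 * cos (x / 2)) s * cos (s * (x / 2) + psi)).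
Proof.
  intros Hs Hx. destruct (is_series_gbinom_trig s x Hs Hx) as [HC HD].
  apply (is_series_scal_r (cos psi)) in HC. apply (is_series_scal_r (sin psi)) in HD.
  assert (H := is_series_minus _ _ _ _ HC HD).
  rewrite cos_plus.
  replace (Rpower (2 * cos (x / 2)) s * (cos (s * (x / 2)) * cos psi - sin (s * (x / 2)) * sin psi))
    with (minus (Rpower (2 * cos (x / 2)) s * cos (s * (x / 2)) * cos psi)
                (Rpower (2 * cos (x / 2)) s * sin (s * (x / 2)) * sin psi))
    by (unfold minus, plus, opp; simpl; ring).
  revert H. apply is_series_ext. intros i. unfold gbinom_cos, gbinom_sin.
  rewrite cos_plus. unfold minus, plus, opp; simpl. ring.
Qed.

(** * Selecting a residue class *)

Lemma sin_nat_PI (k : nat) : sin (INR k * PI) = 0.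
Proof.
  induction k as [|k IH].
  - simpl. rewrite Rmult_0_l. apply sin_0.
  - rewrite S_INR, Rmult_plus_distr_r, Rmult_1_l, neg_sin, IH. ring.
Qed.

Lemma cos_nat_PI (k : nat) : cos (INR k * PI) = (-1) ^ k.
Proof.
  induction k as [|k IH].
  - simpl. rewrite Rmult_0_l. apply cos_0.
  - rewrite S_INR, Rmult_plus_distr_r, Rmult_1_l, neg_cos, IH. simpl. ring.
Qed.

(** Telescoping of [2 sin (y/2) cos (j y) = sin (j y + y/2) - sin (j y - y/2)]. *)
Lemma Dirichlet_kernel (y : R) (m : nat) :
  sin (y / 2) * (1 + 2 * sum_n_m (fun j => cos (INR j * y)) 1 m) = sin (INR m * y + y / 2).
Proof.
  induction m as [|m IH].
  - rewrite sum_n_m_zero by lia. unfold zero; simpl. rewrite Rmult_0_l, Rplus_0_l. ring.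
  - rewrite sum_n_Sm by lia. unfold plus; simpl plus. rewrite S_INR.
    transitivity (sin (y / 2) * (1 + 2 * sum_n_m (fun j => cos (INR j * y)) 1 m)
      + 2 * sin (y / 2) * cos ((INR m + 1) * y)); [simpl; ring|].
    rewrite IH. replace (INR m * y + y / 2) with ((INR m + 1) * y - y / 2) by field.
    rewrite sin_minus, sin_plus. ring.
Qed.

(* The sum of the [i - r]-th powers of the [2 n]-th roots of unity [exp (i pi j / n)],
   [- n < j <= n]. *)
Definition residue_kernel (n r i : nat) : R :=
  1 + 2 * sum_n_m (fun j => cos (INR i * (PI * INR j / INR n) + - (INR r * (PI * INR j / INR n))))
            1 (n - 1) + (-1) ^ (i + r).

(** For [q = r] all [2 n] roots contribute 1. Otherwise the Dirichlet kernel at [y = pi (q - r) / n]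
    gives [sin (n y - y/2) = - (-1)^(q + r) sin (y/2)], which cancels the contribution of the root
    -1. *)
Lemma residue_kernel_eq (n r k q : nat) :
  (1 <= n)%nat -> (r < 2 * n)%nat -> (q < 2 * n)%nat ->
  residue_kernel n r (2 * n * k + q) = if Nat.eq_dec q r then 2 * INR n else 0.
Proof.
  intros Hn Hr Hq. unfold residue_kernel.
  assert (Hn0 : 0 < INR n) by (apply lt_0_INR; lia).
  set (y := PI * (INR q - INR r) / INR n).
  rewrite (sum_n_m_ext _ (fun j => cos (INR j * y))).
  (* The block index [k] only adds the angle [2 pi j k]. *)
  2: { intros j. symmetry. rewrite <- (cos_period _ (j * k)). f_equal.
       rewrite plus_INR, !mult_INR. unfold y. simpl (INR 2). field. lra. }
  replace ((-1) ^ (2 * n * k + q + r)) with ((-1) ^ q * (-1) ^ r).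
  2: { rewrite <- Nat.add_assoc, <- Nat.mul_assoc, (pow_add _ (2 * _)), pow_1_even, pow_add. ring. }
  destruct (Nat.eq_dec q r) as [->|Hqr].
  - assert (Hy : y = 0) by (unfold y; field; lra). rewrite Hy.
    rewrite (sum_n_m_ext _ (fun _ => 1)) by (intros; rewrite Rmult_0_r; apply cos_0).
    rewrite sum_n_m_const, <- pow_add.
    replace (r + r)%nat with (2 * r)%nat by lia. rewrite pow_1_even.
    replace (S (n - 1) - 1)%nat with (n - 1)%nat by lia.
    rewrite minus_INR by lia. simpl (INR 1). ring.
  - assert (HD := Dirichlet_kernel y (n - 1)).
    replace (INR (n - 1) * y + y / 2) with (INR q * PI - INR r * PI - y / 2) in HD.
    2: { rewrite minus_INR by lia. unfold y. simpl (INR 1). field. lra. }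
    rewrite sin_minus, sin_minus, cos_minus, !sin_nat_PI, !cos_nat_PI in HD.
    (* Since [q] and [r] are distinct and below [2 n], the angle [y / 2] is nonzero and lies
       strictly between [- pi] and [pi]. *)
    assert (Hs : sin (y / 2) <> 0).
    { assert (HPI := PI_RGT_0).
      assert (Hy : y / 2 * (2 * INR n) = PI * (INR q - INR r)) by (unfold y; field; lra).
      assert (Hq' : INR q < 2 * INR n) by (apply lt_INR in Hq; rewrite mult_INR in Hq; exact Hq).
      assert (Hr' : INR r < 2 * INR n) by (apply lt_INR in Hr; rewrite mult_INR in Hr; exact Hr).
      assert (Hq0 := pos_INR q). assert (Hr0 := pos_INR r).
      destruct (Nat.lt_total q r) as [Hlt|[He|Hlt]]; [| lia |]; apply lt_INR in Hlt.
      - assert (0 < sin (- (y / 2))) by (apply sin_gt_0; nra). rewrite sin_neg in H. lra.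
      - assert (0 < sin (y / 2)) by (apply sin_gt_0; nra). lra. }
    apply Rmult_eq_reg_l with (sin (y / 2)); [| exact Hs]. lra.
Qed.

Lemma sum_n_m_Rmult_l (c : R) (u : nat -> R) (n m : nat) :
  sum_n_m (fun k => c * u k) n m = c * sum_n_m u n m.
Proof. exact (sum_n_m_mult_l (K := R_Ring) c u n m). Qed.

Lemma is_series_finite_sum (a : nat -> nat -> R) (l : nat -> R) (m : nat) :
  (forall j, (1 <= j <= m)%nat -> is_series (a j) (l j)) ->
  is_series (fun i => sum_n_m (fun j => a j i) 1 m) (sum_n_m l 1 m).
Proof.
  induction m as [|m IH]; intros H.
  - rewrite sum_n_m_zero by lia. apply (is_series_ext (fun _ => 0 * 0)).
    + intros i. rewrite sum_n_m_zero by lia. apply Rmult_0_l.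
    + apply (is_lim_seq_ext (fun _ => 0) _ (Finite 0)); [| apply is_lim_seq_const].
      intros i. rewrite sum_n_const. ring.
  - rewrite sum_n_Sm by lia.
    apply (is_series_ext (fun i => plus (sum_n_m (fun j => a j i) 1 m) (a (S m) i))).
    + intros i. now rewrite sum_n_Sm by lia.
    + apply (is_series_plus (V := R_NormedModule)); [apply IH; intros; apply H; lia | apply H; lia].
Qed.

(** Each block of length [l] holds at most one nonzero term, so the partial sums of [c] are those of
    [a] at the block ends, a subsequence of a convergent sequence. *)
Lemma is_series_residue_class (a c : nat -> R) (l r : nat) (L : R) :
  (r < l)%nat ->
  (forall k q, (q < l)%nat -> a (l * k + q)%nat = if Nat.eq_dec q r then c k else 0) ->
  is_series a L -> is_series c L.
Proof.
  intros Hr Ha HL.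
  assert (Hblock : forall k m, (m < l)%nat ->
    sum_n_m a (l * k) (l * k + m) = if le_dec r m then c k else 0).
  { intros k m. induction m as [|m IH]; intros Hm.
    - rewrite Nat.add_0_r, sum_n_n, <- (Nat.add_0_r (l * k)), Ha by easy.
      destruct (Nat.eq_dec 0 r), (le_dec r 0); easy || lia.
    - rewrite Nat.add_succ_r, sum_n_Sm, IH, <- Nat.add_succ_r, Ha by lia.
      unfold plus; simpl plus.
      destruct (Nat.eq_dec (S m) r), (le_dec r m), (le_dec r (S m)); try lia; simpl; ring. }
  assert (Hsum : forall K, sum_n a (l * K + (l - 1)) = sum_n c K).
  { induction K as [|K IH].
    - rewrite sum_O. unfold sum_n. rewrite <- (Nat.mul_0_r l) at 1. rewrite Hblock by lia.
      destruct (le_dec r (l - 1)); [easy | lia].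
    - rewrite sum_Sn, <- IH. unfold sum_n.
      rewrite (sum_n_m_Chasles a 0 (l * K + (l - 1))) by nia.
      replace (S (l * K + (l - 1))) with (l * S K)%nat by nia. rewrite Hblock by lia.
      destruct (le_dec r (l - 1)); [easy | lia]. }
  apply (is_lim_seq_ext (fun K => sum_n a (l * K + (l - 1))) _ (Finite L)).
  - exact Hsum.
  - apply (is_lim_seq_subseq (sum_n a) L (fun K => l * K + (l - 1))%nat).
    + apply eventually_subseq. intros K. nia.
    + exact HL.
Qed.

(** Roots-of-unity filter: weighting [gbinom s] by [residue_kernel] splits into the series at
    [z = 1], at the conjugate pairs, and at [z = -1]. *)
Lemma is_series_gbinom_residue (s : R) (n r : nat) :
  0 < s < 1 -> (1 <= n)%nat -> (r < 2 * n)%nat ->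
  is_series (fun k => gbinom s (2 * n * k + r))
    (Rpower 2 s * (1 + 2 * sum_n_m (fun j =>
       Rpower (cos (PI * INR j / (2 * INR n))) s *
       cos (PI * INR j * (s - 2 * INR r) / (2 * INR n))) 1 (n - 1)) / (2 * INR n)).
Proof.
  intros Hs Hn Hr. assert (Hn0 : 0 < INR n) by (apply lt_0_INR; lia).
  assert (HPI := PI_RGT_0).
  set (T := fun j => Rpower (cos (PI * INR j / (2 * INR n))) s *
       cos (PI * INR j * (s - 2 * INR r) / (2 * INR n))).
  assert (H0 : is_series (gbinom s) (Rpower 2 s)).
  { assert (H := is_series_gbinom_cos_shift s 0 0 Hs ltac:(lra)).
    replace (Rpower (2 * cos (0 / 2)) s * cos (s * (0 / 2) + 0)) with (Rpower 2 s) in H.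
    2: { replace (0 / 2) with 0 by field. rewrite Rmult_0_r, Rplus_0_l, cos_0, !Rmult_1_r. easy. }
    revert H. apply is_series_ext. intros i.
    rewrite Rmult_0_r, Rplus_0_l, cos_0, Rmult_1_r. easy. }
  assert (Hj : forall j, (1 <= j <= n - 1)%nat ->
    is_series (fun i => gbinom s i *
      cos (INR i * (PI * INR j / INR n) + - (INR r * (PI * INR j / INR n))))
      (Rpower 2 s * T j)).
  { intros j Hj. assert (Hj1 : INR j < INR n) by (apply lt_INR; lia).
    assert (Hj0 := pos_INR j).
    assert (Hx : 0 <= PI * INR j / INR n < PI).
    { assert (He : PI * INR j / INR n * INR n = PI * INR j) by (field; lra). split; nra. }
    assert (H := is_series_gbinom_cos_shift s _ (- (INR r * (PI * INR j / INR n))) Hs Hx).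
    unfold T. rewrite <- Rmult_assoc, Rpower_mult_distr.
    - replace (PI * INR j / (2 * INR n)) with (PI * INR j / INR n / 2) by (field; lra).
      replace (PI * INR j * (s - 2 * INR r) / (2 * INR n))
        with (s * (PI * INR j / INR n / 2) + - (INR r * (PI * INR j / INR n))) by (field; lra).
      exact H.
    - lra.
    - replace (PI * INR j / (2 * INR n)) with (PI * INR j / INR n / 2) by (field; lra).
      apply cos_gt_0; lra. }
  apply is_series_finite_sum in Hj. apply (is_series_scal_r 2) in Hj.
  (* The point [z = -1] adds 0 to the sum but completes the kernel term by term. *)
  assert (Ha := is_series_alternating_gbinom s Hs). apply (is_series_scal_r ((-1) ^ r)) in Ha.
  assert (H := is_series_plus _ _ _ _ (is_series_plus _ _ _ _ H0 Hj) Ha).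
  apply (is_series_residue_class _ (fun k => 2 * INR n * gbinom s (2 * n * k + r)) (2 * n) r) in H.
  - apply (is_series_scal_r (/ (2 * INR n))) in H.
    replace (Rpower 2 s * (1 + 2 * sum_n_m T 1 (n - 1))) with
      (plus (plus (Rpower 2 s) (sum_n_m (fun j => Rpower 2 s * T j) 1 (n - 1) * 2))
        (0 * (-1) ^ r)).
    + revert H. apply is_series_ext. intros k. apply Rinv_r_simpl_m. lra.
    + rewrite sum_n_m_Rmult_l. unfold plus; simpl. ring.
  - exact Hr.
  - intros k q Hq.
    transitivity (gbinom s (2 * n * k + q) * residue_kernel n r (2 * n * k + q)).
    + unfold residue_kernel. rewrite sum_n_m_Rmult_l.
      generalize (2 * n * k + q)%nat. intros i. rewrite pow_add.
      unfold plus; simpl. ring.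
    + rewrite residue_kernel_eq by easy. destruct (Nat.eq_dec q r) as [->|_]; ring.
Qed.

(** * The closed form of the coefficients *)

Theorem mainTheorem1 (alpha : R) (n p : nat)
    (halpha : 0 < alpha < 1) (hn : (1 <= n)%nat) (hp : (1 <= p <= 2 * n)%nat) :
  ex_series (S_term alpha p (2 * n)) /\
  S_coef alpha p (2 * n) =
    Gamma alpha * Rpower 2 (- alpha) / INR n * (-1) ^ p *
    (1 + 2 * sum_n_m (fun j : nat =>
           Rpower (cos (PI * INR j / (2 * INR n))) (1 - alpha) *
           cos (PI * INR j * (2 * INR p + alpha - 3) / (2 * INR n)))
         1 (n - 1)).
Proof.
  assert (Hn0 : 0 < INR n) by (apply lt_0_INR; lia).
  assert (H := is_series_gbinom_residue (1 - alpha) n (p - 1) ltac:(lra) hn ltac:(lia)).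
  apply (is_series_scal_r (Gamma alpha * (-1) ^ p)) in H.
  assert (Hterm : forall k, gbinom (1 - alpha) (2 * n * k + (p - 1)) * (Gamma alpha * (-1) ^ p) =
    S_term alpha p (2 * n) k).
  { intros k. rewrite S_term_gbinom by easy || lia.
    (* As the period is even, the sign does not depend on [k] and factors out of the series. *)
    replace ((-1) ^ (2 * n * k + (p - 1))) with (- (-1) ^ p); [ring|].
    rewrite pow_add, <- Nat.mul_assoc, pow_1_even.
    destruct p as [|p]; [lia|]. rewrite Nat.sub_succ, Nat.sub_0_r. simpl. ring. }
  apply (is_series_ext _ _ _ Hterm) in H.
  split; [eexists; exact H|]. unfold S_coef. rewrite (is_series_unique _ _ H).
  (* The extracted 2 cancels against the number [2 n] of roots of unity. *)
  replace (Rpower 2 (1 - alpha)) with (2 * Rpower 2 (- alpha)).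
  2: { unfold Rminus. rewrite Rpower_plus, Rpower_1 by lra. reflexivity. }
  rewrite (sum_n_m_ext _ (fun j => Rpower (cos (PI * INR j / (2 * INR n))) (1 - alpha) *
         cos (PI * INR j * (2 * INR p + alpha - 3) / (2 * INR n)))).
  - field. lra.
  (* With [s = 1 - alpha] and [r = p - 1], [s - 2 r = - (2 p + alpha - 3)], and the cosine is
     even. *)
  - intros j. f_equal. rewrite <- cos_neg. f_equal.
    rewrite minus_INR by lia. simpl (INR 1). field. lra.
Qed.
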